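(* Let $n$ be a positive integer, let $p$ be a prime and let $m$ be an integer with $1\leq m\leq p-1$. For any $(m,m)$-town$\pmod p$ family $\mathcal{F}\subseteq\mathscr{P}(n)$ we have $|\mathcal{F}|\leq 2^{\left\lfloor\frac{n+1}{2}\right\rfloor}$.
   Context: $[n]=\{1,2,\ldots,n\}$ and $\mathscr{P}(n)$ is the power set of $[n]$; a family $\mathcal{F}\subseteq\mathscr{P}(n)$ is a set of (distinct) subsets of $[n]$. For integers $k\ge 2$ and $0\le a,b\le k-1$, a family $\mathcal{F}\subseteq\mathscr{P}(n)$ is an $(a,b)$-town$\pmod k$ if for any distinct $A,B\in\mathcal{F}$ we have $|A|\equiv a\pmod k$ and $|A\cap B|\equiv b\pmod k$; that is, every set in $\mathcal{F}$ has cardinality $\equiv a\pmod k$ and every intersection of two distinct sets of $\mathcal{F}$ has cardinality $\equiv b\pmod k$. *)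

(* Defs.v *)
From mathcomp Require Import all_boot.

Set Implicit Arguments.
Unset Strict Implicit.
Unset Printing Implicit Defensive.

(* The ground set [n] = {1, ..., n} is represented by 'I_n = {0, ..., n-1}. *)
Definition town (k a b n : nat) (F : {set {set 'I_n}}) : Prop :=
  (forall A : {set 'I_n}, A \in F -> #|A| = a %[mod k]) /\
  (forall A B : {set 'I_n}, A \in F -> B \in F -> A != B ->
     #|A :&: B| = b %[mod k]).

(* Main.v *)
Require Import Defs.
From mathcomp Require Import all_boot.
From mathcomp Require Import all_algebra.

(** The incidence matrix [M] of [F] over [F_p] satisfies [M M^T = m J], where [J]
    is the all-ones matrix, so Sylvester's rank inequality gives
    [2 rank M - n <= rank (m J) <= 1]. On the other hand [rank M] columns of [M]
    determine all the others, so a set of [F] is determined by its trace on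
    [rank M] points, whence [#|F| <= 2 ^ rank M]. *)

Import GRing.Theory.
Open Scope ring_scope.

Definition incidence_mx (R : nzRingType) (n : nat) (F : {set {set 'I_n}}) :
    'M[R]_(#|F|, n) :=
  \matrix_(i < #|F|, j < n) (j \in enum_val i)%:R.

Lemma card_le_exp_rank_incidence_mx (K : fieldType) (n : nat)
    (F : {set {set 'I_n}}) :
  (#|F| <= 2 ^ \rank (incidence_mx K n F))%N.
Proof.
set M := incidence_mx K n F.
(* [f] selects points whose columns in [M] form a basis of the column space; transposing is what
   lets row-space lemmas apply. *)
pose f := maxrankfun M^T.
pose trace (A : {set 'I_n}) := [set j : 'I_(\rank M^T) | f j \in A].
have /submxP [D MtE] : (M^T <= rowsub f M^T)%MS by rewrite eq_maxrowsub.
have trace_inj : {in F &, injective trace}.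
  move=> A B AF BF /setP eqAB; apply/setP => x.
  suff: (x \in A)%:R = (x \in B)%:R :> K.
    by case: (x \in A); case: (x \in B) => // /eqP;
      rewrite ?oner_eq0 // eq_sym oner_eq0.
  (* Row [x] of [MtE] expresses the column of [x] through the selected ones. Its coefficients
     [D x j] do not depend on [C], so [trace C] decides whether [x] lies in [C]. *)
  have entryE C (CF : C \in F) :
      (x \in C)%:R = \sum_j D x j * (j \in trace C)%:R :> K.
    have := congr1 (fun N : 'M__ => N x (enum_rank_in CF C)) MtE.
    rewrite !mxE enum_rankK_in // => ->.
    by apply: eq_bigr => j _; rewrite !mxE enum_rankK_in // inE.
  by rewrite !entryE //; apply: eq_bigr => j _; rewrite eqAB.
rewrite -[leqLHS](card_in_imset trace_inj) -[in leqRHS]mxrank_tr.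
rewrite -[in leqRHS](card_ord (\rank M^T)) -cardsT -card_powerset.
by apply/subset_leq_card/subsetP => A _; rewrite powersetE subsetT.
Qed.

Lemma incidence_mx_mul_tr (R : nzRingType) (n : nat) (F : {set {set 'I_n}})
    (i j : 'I_#|F|) :
  (incidence_mx R n F *m (incidence_mx R n F)^T) i j =
  #|enum_val i :&: enum_val j|%:R.
Proof.
rewrite mxE -[in RHS]sum1_card natr_sum [RHS]big_mkcond /=.
apply: eq_bigr => x _; rewrite !mxE inE.
by case: (x \in enum_val i); case: (x \in enum_val j); rewrite ?mulr0 ?mul0r ?mulr1.
Qed.

(** An outer product of a column and a row factors through dimension one. *)
Lemma rank_const_mx (K : fieldType) (q n : nat) (c : K) :
  (\rank (const_mx c : 'M_(q, n)) <= 1)%N.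
Proof.
have -> : const_mx c = (const_mx c : 'cV_q) *m (const_mx 1 : 'rV_n).
  by apply/matrixP => i j; rewrite !mxE big_ord1 !mxE mulr1.
exact: leq_trans (mxrankM_maxr _ _) (rank_leq_row _).
Qed.

Close Scope ring_scope.

Theorem proposition1p4 (n p m : nat) (F : {set {set 'I_n}}) :
  0 < n -> prime p -> 1 <= m <= p - 1 ->
  town p m m F ->
  #|F| <= 2 ^ ((n + 1) %/ 2).
Proof.
move=> _ p_pr _ [cardF capF].
set M := incidence_mx 'F_p n F.
have MMt : (M *m M^T = const_mx m%:R)%R.
  apply/matrixP => i j; rewrite incidence_mx_mul_tr mxE.
  have natr_Fp_eq a b : a = b %[mod p] -> (a%:R = b%:R :> 'F_p)%R.
    by move=> ab; rewrite -(Fp_nat_mod p_pr) ab Fp_nat_mod.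
  apply: natr_Fp_eq.
  (* The diagonal holds set sizes and the rest holds intersection sizes; both residues being [m]
     makes the matrix constant. *)
  have [->|neq_ij] := eqVneq i j; first by rewrite setIid cardF ?enum_valP.
  by rewrite capF ?enum_valP // (inj_eq enum_val_inj).
(* Sylvester's inequality, giving [2 * \rank M <= n + 1]. *)
have := mxrank_mul_min M M^T; rewrite MMt mxrank_tr.
move=> /leq_trans/(_ (rank_const_mx _ _ _ _)); rewrite leq_subLR addnn => rankM.
apply: leq_trans (card_le_exp_rank_incidence_mx 'F_p n F) _.
by rewrite leq_exp2l // leq_divRL // muln2.
Qed.
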